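(* Suppose $k\notin\mathbb Q$ and let $\chi=(a_1,\dots,a_n\mid b_1,\dots,b_m)$ and $\tilde\chi=(\tilde a_1,\dots,\tilde a_n\mid\tilde b_1,\dots,\tilde b_m)$ be elements of $X^+(n,m)$. Then the conditions $b^{(n,m)}_r(\chi)=b^{(n,m)}_r(\tilde\chi)$ for all $r=1,2,\dots$ are equivalent to the condition $$\Gamma_a\cup\hat\Gamma_b=\Gamma_{\tilde a}\cup\hat\Gamma_{\tilde b}.$$
   Context: $n,m$ are positive integers, $k\in\mathbb C$. $X^+(n,m)$ is the set of $\chi=(a_1,\dots,a_n\mid b_1,\dots,b_m)\in\mathbb Z^n\oplus\mathbb Z^m$ with $a_1\ge\dots\ge a_n$ and $b_1\ge\dots\ge b_m$. With $B_r(x)$ the Bernoulli polynomials, put $b_r(x_1,\dots,x_N,\kappa,h)=\sum_{i=1}^N\left[B_r(x_i+\kappa(i-1)+h)-B_r(\kappa(i-1)+h)\right]$ and $$b^{(n,m)}_r(\xi)=b_r(\xi_1,\dots,\xi_n,k,0)+k^{r-1}b_r(\xi_{n+1},\dots,\xi_{n+m},k^{-1},n).$$ For a non-increasing sequence of integers $a=(a_1,\dots,a_n)$ let $M_{2i-1}=(a_i,i-1)$, $M_{2i}=(a_i,i)$ for $1\le i\le n$, $M_0=(+\infty,0)$, $M_{2n+1}=(-\infty,n)$, and let $\Gamma_a=\bigcup_{i=0}^{2n}[M_i,M_{i+1}]\subset\mathbb R^2$ (the first and last segments being horizontal half-lines). For a non-increasing sequence of integers $b=(b_1,\dots,b_m)$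 let $N_{2j-1}=(j-1,n+b_j)$, $N_{2j}=(j,n+b_j)$ for $1\le j\le m$, $N_0=(0,+\infty)$, $N_{2m+1}=(m,-\infty)$, and $\hat\Gamma_b=\bigcup_{j=0}^{2m}[N_j,N_{j+1}]$ (the first and last segments being vertical half-lines). *)

(* Defs.v *)
From HB Require Import structures.
From mathcomp Require Import all_boot all_order all_algebra.
From mathcomp Require Import complex.
From mathcomp Require Import boolp classical_sets reals.

Set Implicit Arguments.
Unset Strict Implicit.
Unset Printing Implicit Defensive.

Import Order.TTheory GRing.Theory Num.Theory.

Local Open Scope classical_set_scope.
Local Open Scope ring_scope.

Section Bernoulli.
Variable C : numFieldType.

(* [:: B_0; ...; B_(n-1)]. Comparing coefficients in
     (e^t - 1) * \sum_j B_j t^j / j! = t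
   gives \sum_(j <= n) 'C(n+1, j) B_j = (n == 0), solved here for B_n. *)
Fixpoint bernoulli_seq (n : nat) : seq C :=
  if n is n'.+1 then
    let s := bernoulli_seq n' in
    rcons s (((n' == 0)%:R - \sum_(j < n') 'C(n'.+1, j)%:R * s`_j) / n'.+1%:R)
  else [::].

Definition bernoulli (n : nat) : C := (bernoulli_seq n.+1)`_n.

(* Coefficient form of t e^(xt) / (e^t - 1) = \sum_r B_r(x) t^r / r!. *)
Definition bernoulli_poly (r : nat) : {poly C} :=
  \sum_(j < r.+1) ('C(r, j)%:R * bernoulli j) *: 'X^(r - j).

Lemma size_bernoulli_seq n : size (bernoulli_seq n) = n.
Proof. by elim: n => //= n IHn; rewrite size_rcons IHn. Qed.

Lemma nth_bernoulli_seq n j : (j < n)%N -> (bernoulli_seq n)`_j = bernoulli j.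
Proof.
elim: n => // n IHn; rewrite ltnS leq_eqVlt => /predU1P[-> //|ltjn].
by rewrite /= nth_rcons size_bernoulli_seq ltjn IHn.
Qed.

Lemma bernoulli_rec n :
  \sum_(j < n.+1) 'C(n.+1, j)%:R * bernoulli j = (n == 0)%:R.
Proof.
have nz : n.+1%:R != 0 :> C by rewrite pnatr_eq0.
rewrite big_ord_recr /= binSn {2}/bernoulli /=.
rewrite nth_rcons size_bernoulli_seq ltnn eqxx mulrC divfK //.
by under eq_bigr => j _ do rewrite -(nth_bernoulli_seq (ltn_ord j)); rewrite addrC subrK.
Qed.

(* Indices start at 0, so the shift kappa (i - 1) becomes kappa * i. *)
Definition bsum (r : nat) (x : seq C) (kappa h : C) : C :=
  \sum_(i < size x) ((bernoulli_poly r).[x`_i + kappa * i%:R + h]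
                     - (bernoulli_poly r).[kappa * i%:R + h]).

(* Only meaningful for 0 < r, because of the truncated exponent r.-1. *)
Definition deformed_bsum (n m r : nat) (k : C) (xi : (n + m).-tuple C) : C :=
  bsum r (take n xi) k 0 + k ^+ r.-1 * bsum r (drop n xi) k^-1 n%:R.

Definition weight_tuple (n m : nat) (chi : n.-tuple int * m.-tuple int) :
    (n + m).-tuple C :=
  [tuple of [seq z%:~R | z <- chi.1 ++ chi.2]].

End Bernoulli.

Arguments deformed_bsum {C} n m r k xi.
Arguments weight_tuple C {n m} chi.

Definition Xplus (n m : nat) : {pred n.-tuple int * m.-tuple int} :=
  [pred chi | sorted >=%R (val chi.1) && sorted >=%R (val chi.2)].
Arguments Xplus n m : clear implicits.

Section Curves.
Variable R : realType.

Definition segment (P Q : R * R) : set (R * R) :=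
  [set z : R * R | exists2 t : R, 0 <= t <= 1 &
     z = ((1 - t) * P.1 + t * Q.1, (1 - t) * P.2 + t * Q.2)].

(* M_p for 1 <= p <= 2n: p = 2i - 1 gives (a_i, i - 1), p = 2i gives (a_i, i);
   the entry a_i is a`_(i - 1). *)
Definition Mpoint (n : nat) (a : n.-tuple int) (p : nat) : R * R :=
  ((a`_(p.-1./2))%:~R, (p./2)%:R).

(* The first and last sets are [M_0, M_1] and [M_(2n), M_(2n+1)]. *)
Definition Gamma (n : nat) (a : n.-tuple int) : set (R * R) :=
  [set z : R * R | (Mpoint a 1).1 <= z.1 /\ z.2 = (Mpoint a 1).2]
  `|` \bigcup_(p in [set p | (1 <= p < n.*2)%N])
        segment (Mpoint a p) (Mpoint a p.+1)
  `|` [set z : R * R | z.1 <= (Mpoint a n.*2).1 /\ z.2 = (Mpoint a n.*2).2].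

(* N_p for 1 <= p <= 2m: p = 2j - 1 gives (j - 1, n + b_j), p = 2j gives
   (j, n + b_j). *)
Definition Npoint (n m : nat) (b : m.-tuple int) (p : nat) : R * R :=
  ((p./2)%:R, n%:R + (b`_(p.-1./2))%:~R).

Definition hatGamma (n m : nat) (b : m.-tuple int) : set (R * R) :=
  [set z : R * R | z.1 = (Npoint n b 1).1 /\ (Npoint n b 1).2 <= z.2]
  `|` \bigcup_(p in [set p | (1 <= p < m.*2)%N])
        segment (Npoint n b p) (Npoint n b p.+1)
  `|` [set z : R * R | z.1 = (Npoint n b m.*2).1 /\ z.2 <= (Npoint n b m.*2).2].

End Curves.

Arguments Gamma R {n} a.
Arguments hatGamma R n {m} b.

(* Main.v *)
(* Write z(x, y) = x + k y for integers x, y.  Telescoping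
   B_r(c + 1) - B_r(c) = r c^(r-1) expresses both halves of b_r(chi) - b_r(chi')
   through unit cells: the row of length a_i at height i - 1 and the column of
   height n + b_j at abscissa j - 1 contribute r z(x, y)^(r-1) for each of their
   cells.  Hence
     b_r(chi) - b_r(chi') = r \sum_(x, y) (w - w')(x, y) z(x, y)^(r-1),
   where w(x, y) in {0, 1, 2} counts the staircases among Gamma_a, hatGamma_b
   having the cell (x, y) on their lower left.  Since k is irrational the z(x, y)
   are distinct, so all these moments vanish iff w = w'.  On the other side, a
   point lies on Gamma_a or hatGamma_b iff w drops between the cells on its lower
   left and on its upper right, so w determines the union of the curves.
   Conversely w drops at most twice along each row, by 2 in total inside the strip
   0 <= y < n and by 1 outside it, so the positions of the drops determine w. *)

Require Import Defs.
From HB Require Import structures.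
From mathcomp Require Import all_boot all_order all_algebra.
From mathcomp Require Import complex zify ring lra.
From mathcomp Require Import boolp classical_sets reals.

Set Implicit Arguments.
Unset Strict Implicit.
Unset Printing Implicit Defensive.

Import Order.TTheory GRing.Theory Num.Theory.

Local Open Scope classical_set_scope.
Local Open Scope ring_scope.

(** * The difference equation of Bernoulli polynomials *)

(** Both sides are the trinomial coefficient [s! / (i! j! (s - i - j)!)]. *)
Lemma mul_bin_swap s i j : (i + j <= s)%N ->
  ('C(s, j) * 'C(s - j, i) = 'C(s, i) * 'C(s - i, j))%N.
Proof.
move=> le_ij_s.
have Hj := @bin_fact s j ltac:(lia); have Hi := @bin_fact s i ltac:(lia).
have Hji := @bin_fact (s - j) i ltac:(lia).
have Hij := @bin_fact (s - i) j ltac:(lia).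
rewrite (_ : (s - i - j = s - j - i)%N) in Hij; last by lia.
have := fact_gt0 i; have := fact_gt0 j; have := fact_gt0 (s - j - i).
set f1 := _`!; set f2 := _`!; set f3 := _`! => f1_gt0 f2_gt0 f3_gt0.
apply/eqP; rewrite -(eqn_pmul2r (_ : 0 < f1 * f2 * f3)%N) ?muln_gt0 ?f1_gt0 ?f2_gt0//.
apply/eqP; transitivity s`!.
  rewrite -Hj -Hji -/f1 -/f2 -/f3; ring.
rewrite -Hi -Hij -/f1 -/f2 -/f3; ring.
Qed.

Lemma exprD1_sub (C : comPzRingType) (x : C) n :
  (x + 1) ^+ n - x ^+ n = \sum_(i < n) 'C(n, i)%:R * x ^+ i.
Proof.
rewrite addrC [x + 1]addrC exprDn big_ord_recr /= binn expr1n mul1r mulr1n.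
rewrite addrCA addNr addr0; apply: eq_bigr => i _.
by rewrite expr1n mul1r mulr_natl.
Qed.

(** After expanding [(x + 1) ^+ (r.+1 - j)] and exchanging sums, the coefficient of [x ^+ i] is
    ['C(r.+1, i)] times the sum in [bernoulli_rec], which vanishes unless [i = r]. *)
Lemma bernoulli_poly_step (C : numFieldType) r (x : C) :
  (bernoulli_poly C r.+1).[x + 1] - (bernoulli_poly C r.+1).[x]
  = r.+1%:R * x ^+ r.
Proof.
have E y : (bernoulli_poly C r.+1).[y] =
    \sum_(j < r.+2) 'C(r.+1, j)%:R * bernoulli C j * y ^+ (r.+1 - j).
  rewrite /bernoulli_poly horner_sum; apply: eq_bigr => j _.
  by rewrite hornerZ hornerXn.
rewrite !E -sumrB.
transitivity (\sum_(j < r.+2) \sum_(i < r.+1 | (i < r.+1 - j)%N)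
    'C(r.+1, i)%:R * x ^+ i * ('C(r.+1 - i, j)%:R * bernoulli C j)).
  apply: eq_bigr => j _; rewrite -mulrBr exprD1_sub mulr_sumr.
  rewrite (big_ord_widen r.+1 (fun i =>
    'C(r.+1, j)%:R * bernoulli C j * ('C(r.+1 - j, i)%:R * x ^+ i))) ?leq_subr//.
  apply: eq_bigr => i ltij.
  have := @mul_bin_swap r.+1 i j ltac:(lia).
  move=> /(congr1 (fun t => t%:R : C)); rewrite !natrM => H.
  transitivity ('C(r.+1, j)%:R * 'C(r.+1 - j, i)%:R * (bernoulli C j * x ^+ i)).
    by ring.
  by rewrite H; ring.
rewrite (exchange_big_dep predT)//= (bigD1 ord_max)//= [X in _ + X]big1 ?addr0.
  rewrite subSnn (eq_bigl (fun j : 'I_r.+2 => (j < 1)%N)); last by move=> j; lia.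
  rewrite -(big_ord_widen r.+2 (fun j =>
    'C(r.+1, r)%:R * x ^+ r * ('C(1, j)%:R * bernoulli C j)))//.
  by rewrite -mulr_sumr bernoulli_rec mulr1 binSn.
move=> i /eqP ne_ir.
have lt_ir : (i < r)%N.
  by have := ltn_ord i;
     have : (i <> r :> nat) by [move=> e; apply: ne_ir; exact: val_inj]; lia.
rewrite (eq_bigl (fun j : 'I_r.+2 => (j < r.+1 - i)%N)); last by move=> j; lia.
rewrite -(big_ord_widen r.+2 (fun j =>
  'C(r.+1, i)%:R * x ^+ i * ('C(r.+1 - i, j)%:R * bernoulli C j))); last lia.
rewrite -mulr_sumr (_ : (r.+1 - i)%N = (r - i).-1.+2); last lia.
by rewrite bernoulli_rec mulr0.
Qed.

Lemma bernoulli_poly_sum (C : numFieldType) r (c : C) l :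
  (bernoulli_poly C r.+1).[c + l%:R] - (bernoulli_poly C r.+1).[c]
  = r.+1%:R * \sum_(i < l) (c + i%:R) ^+ r.
Proof.
elim: l => [|l IHl]; first by rewrite addr0 subrr big_ord0 mulr0.
rewrite big_ord_recr /= mulrDr -IHl -bernoulli_poly_step -natr1 addrA.
by ring.
Qed.

(** * Finite windows of integers and power moments *)

(** Runs through the integers [-N <= t < N] for [i < N.*2], so that sums over a box of cells become
    sums over ordinals. *)
Definition window N (i : nat) : int := i%:Z - N%:Z.

Lemma bernoulli_poly_window (C : numFieldType) r (c : C) N (a a' : int) :
  `|a| <= N%:Z -> `|a'| <= N%:Z ->
  (bernoulli_poly C r.+1).[a%:~R + c] - (bernoulli_poly C r.+1).[a'%:~R + c]
  = r.+1%:R * \sum_(i < N.*2)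
      ((window N i < a)%R%:R - (window N i < a')%R%:R) * (c + (window N i)%:~R) ^+ r.
Proof.
(* Both values are measured from the common base point [c - N]. *)
have base (b : int) : `|b| <= N%:Z ->
    (bernoulli_poly C r.+1).[b%:~R + c] - (bernoulli_poly C r.+1).[c - N%:R]
    = r.+1%:R * \sum_(i < N.*2) (window N i < b)%R%:R * (c + (window N i)%:~R) ^+ r.
  move=> leb; pose l := absz (b + N%:Z).
  have lE : b = l%:Z - N%:Z by rewrite /l; lia.
  have -> : b%:~R + c = c - N%:R + l%:R by rewrite lE rmorphB /=; ring.
  rewrite bernoulli_poly_sum; congr (_ * _).
  rewrite (big_ord_widen N.*2 (fun i => (c - N%:R + i%:R) ^+ r)); last by lia.
  rewrite big_mkcond /=; apply: eq_bigr => i _.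
  have -> : (window N i < b) = (i < l)%N by rewrite /window; lia.
  case: ifP => _; last by rewrite mul0r.
  by rewrite mul1r /window rmorphB /=; congr (_ ^+ _); ring.
move=> lea lea'.
transitivity (((bernoulli_poly C r.+1).[a%:~R + c] - (bernoulli_poly C r.+1).[c - N%:R])
  - ((bernoulli_poly C r.+1).[a'%:~R + c] - (bernoulli_poly C r.+1).[c - N%:R])).
  by ring.
rewrite !base// -mulrBr -sumrB; congr (_ * _); apply: eq_bigr => i _.
by rewrite -mulrBl.
Qed.

Lemma sum_window (V : nmodType) N n (F : int -> V) : (n <= N)%N ->
  (forall y : int, ~~ (0 <= y < n%:Z) -> F y = 0) ->
  \sum_(i < N.*2) F (window N i) = \sum_(i < n) F i%:Z.
Proof.
move=> lenN F0; rewrite -(big_mkord predT (fun i => F (window N i))).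
rewrite (big_cat_nat (n := N))//=; last by lia.
rewrite big_nat big1 ?add0r; last by move=> i ?; rewrite F0// /window; lia.
rewrite (big_cat_nat (n := N + n)%N)/=; [|lia|lia].
rewrite [X in _ + X]big_nat [X in _ + X]big1 ?addr0; last first.
  by move=> i ?; rewrite F0// /window; lia.
rewrite -{1}(add0n N) big_addn addKn big_mkord; apply: eq_bigr => i _.
by congr F; rewrite /window; lia.
Qed.

(** By linearity the powers may be replaced by any polynomial; one vanishing at every node except
    [z i] isolates [c i]. *)
Lemma moments_eq0 (F : fieldType) (I : finType) (z c : I -> F) :
  injective z -> (forall p, \sum_i c i * z i ^+ p = 0) -> forall i, c i = 0.
Proof.
move=> z_inj mom0 i.
have pol0 (P : {poly F}) : \sum_j c j * P.[z j] = 0.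
  under eq_bigr => j _ do rewrite horner_coef mulr_sumr.
  rewrite exchange_big big1 //= => p _.
  under eq_bigr => j _ do rewrite mulrCA.
  by rewrite -mulr_sumr mom0 mulr0.
have := pol0 (\prod_(j | j != i) ('X - (z j)%:P)).
rewrite (bigD1 i)//= [X in _ + X]big1 ?addr0 => [/eqP|j ne_ji]; last first.
  by rewrite (bigD1 j)//= hornerM hornerXsubC subrr mul0r mulr0.
rewrite mulf_eq0 horner_prod => /orP[/eqP //|].
rewrite prodf_seq_eq0 => /hasP[j _ /andP[ne_ji]].
by rewrite hornerXsubC subr_eq0 => /eqP/z_inj e; rewrite e eqxx in ne_ji.
Qed.

(** * Cells below a staircase *)

(* For [s] non-increasing of size [n]: the unit cell with lower left corner [(x, y)],
   [y] being any integer, lies on the lower left of the staircase [Gamma R s]. *)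
Definition below (s : seq int) (x y : int) : bool := y < (count (> x) s)%:Z.

(** In a non-increasing sequence the entries satisfying an up-closed predicate form a prefix. *)
Lemma count_up_closed (P : pred int) (s : seq int) i :
  (forall x y, x <= y -> P x -> P y) -> sorted >=%R s -> (i < size s)%N ->
  P s`_i = (i < count P s)%N.
Proof.
move=> Pup; elim: s i => // c s IHs i cs; case Pc: (P c).
  case: i => [|i] /=; first by rewrite Pc.
  by rewrite ltnS Pc add1n ltnS; apply: IHs; exact: path_sorted cs.
have cs0 : ~~ has P (c :: s).
  apply/hasPn => d; rewrite inE => /predU1P[->|ds]; first by rewrite Pc.
  move: cs; rewrite /= (path_sortedE (fun _ _ _ a b => le_trans b a)).
  by move=> /andP[/allP/(_ _ ds) ledc _]; apply: contraFN Pc; exact: Pup.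
move=> lti; move: (cs0); rewrite has_count -leqNgt leqn0 => /eqP->.
by apply/negbTE; move/hasPn: cs0; apply; exact: mem_nth.
Qed.

Lemma belowE (s : seq int) x (y : nat) : sorted >=%R s -> (y < size s)%N ->
  below s x y%:Z = (x < s`_y).
Proof.
move=> ss ys; rewrite /below ltz_nat.
by rewrite -(count_up_closed (P := > x)) // => c d /[swap]; exact: lt_le_trans.
Qed.

Lemma below_lt0 s x y : y < 0 -> below s x y.
Proof. by rewrite /below; lia. Qed.

Lemma below_ge_size s x y : (size s)%:Z <= y -> below s x y = false.
Proof.
by have := count_size (> x) s; rewrite /below; move: (count _ _) (size s) => c n; lia.
Qed.

Lemma below_le s x x' y y' : x <= x' -> y <= y' -> below s x' y' -> below s x y.
Proof.
move=> lex ley; rewrite /below.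
suff: (count (> x')%R s <= count (> x)%R s)%N.
  by set c' := count (> x') s; set c := count (> x) s; lia.
by apply: sub_count => c /=; exact: le_lt_trans.
Qed.

(** * The staircases as subsets of the plane *)

Section Gamma.
Variables (R : realType) (n : nat) (a : n.-tuple int).
Hypotheses (n_gt0 : (0 < n)%N) (a_sorted : sorted >=%R (val a)).

Lemma Mpoint_odd q : Mpoint R a q.*2.+1 = ((a`_q)%:~R, q%:R).
Proof. by rewrite /Mpoint /= uphalf_double doubleK. Qed.

Lemma Mpoint_even q : Mpoint R a q.+1.*2 = ((a`_q)%:~R, q.+1%:R).
Proof. by rewrite /Mpoint doubleK doubleS /= uphalf_double. Qed.

(** An abscissa that is no entry meets one horizontal piece, at the height counting the larger
    entries; at an entry, the vertical edges of all equal entries stack up between the two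
    counts. *)
Lemma Gamma_counts (z : R * R) : Gamma R a z <->
  (count (fun c => z.1 < c%:~R) a)%:R <= z.2
  /\ z.2 <= (count (fun c => z.1 <= c%:~R) a)%:R.
Proof.
case: z => X Y; rewrite [(X, Y).1]/= [(X, Y).2]/=.
set g := count _ _; set h := count _ _.
have szg : (g <= n)%N by rewrite -(size_tuple a) count_size.
have szh : (h <= n)%N by rewrite -(size_tuple a) count_size.
have ltg i : (i < n)%N -> (X < (a`_i)%:~R) = (i < g)%N.
  move=> lti; rewrite -(count_up_closed (P := fun c => X < c%:~R)) ?size_tuple//.
  by move=> c d lecd /lt_le_trans; apply; rewrite ler_int.
have lth i : (i < n)%N -> (X <= (a`_i)%:~R) = (i < h)%N.
  move=> lti; rewrite -(count_up_closed (P := fun c => X <= c%:~R)) ?size_tuple//.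
  by move=> c d lecd /le_trans; apply; rewrite ler_int.
have nE : n.*2 = n.-1.+1.*2 by rewrite prednK.
have between q (Y' : R) : (q < n)%N -> X = (a`_q)%:~R -> q%:R <= Y' <= q.+1%:R ->
    g%:R <= Y' /\ Y' <= h%:R.
  move=> ltq XE /andP[leqY leYq].
  have leg : (g <= q)%N by rewrite leqNgt -ltg// XE ltxx.
  have leh : (q < h)%N by rewrite -lth// XE.
  by rewrite (le_trans _ leqY) ?ler_nat// (le_trans leYq) ?ler_nat.
rewrite /Gamma nE Mpoint_even -[1%N]/(0.*2.+1) Mpoint_odd; split.
- case=> [[[/= leX ->]|[p p_int [t /andP[t0 t1]]]]|[/= leX ->]].
  + by rewrite ler0n; split=> //; rewrite lern0 eqn0Ngt -ltg// -leNgt.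
  + have {}p_int : (1 <= p < n.-1.+1.*2)%N by [].
    (* Even [p] gives a horizontal edge, odd [p] a vertical one. *)
    have := odd_double_half p; case: (odd p); last first.
      case: (p./2) => [|q] pE; first by lia.
      rewrite -pE add0n Mpoint_even Mpoint_odd => -[XE ->] /=.
      have ltqn : (q.+1 < n)%N by lia.
      have lea : (a`_q.+1)%:~R <= (a`_q)%:~R :> R.
        by rewrite ler_int; have /sortedP := a_sorted; apply; rewrite size_tuple.
      have -> : (1 - t) * q.+1%:R + t * q.+1%:R = q.+1%:R :> R by ring.
      rewrite !ler_nat leqNgt -ltg// -leNgt -lth ?(ltnW ltqn)// XE.
      by split; nra.
    move=> pE; rewrite -pE add1n -doubleS Mpoint_even Mpoint_odd => -[XE YE].
    apply: (between p./2); first by lia.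
      by rewrite XE /=; ring.
    by rewrite YE /= -natr1; nra.
  + rewrite prednK// !ler_nat; split=> //.
    by have := lth n.-1; rewrite leX prednK// => <-.
- case=> leg leh.
  have [ltgh|legh] := ltnP g h.
    (* [q] is the integer part of [Y], except at the top end [Y = h], where it is [h - 1]. *)
    have [q /andP[legq ltqh] /andP[leqY leYq]] :
        exists2 q, (g <= q < h)%N & q%:R <= Y <= q.+1%:R.
      have [ltYh|leYh] := ltP Y h%:R.
        have Y0 : 0 <= Y by apply: le_trans leg; rewrite ler0n.
        have /andP[leT ltT] := truncn_itv Y0.
        exists (Num.truncn Y); last by rewrite leT ltW.
        rewrite truncn_ge_nat ?leg//= -(ltr_nat R); exact: le_lt_trans ltYh.
      exists h.-1; [lia | rewrite prednK; last lia].
      by rewrite leh (le_trans _ leYh)// ler_nat leq_pred.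
    left; right; exists q.*2.+1 => /=; first by lia.
    exists (Y - q%:R); first by move: leYq; rewrite -natr1; lra.
    rewrite -doubleS Mpoint_even Mpoint_odd /=.
    have XE : X = (a`_q)%:~R.
      by apply/le_anti; rewrite lth ?ltqh ?leNgt ?ltg -?leqNgt ?legq//; lia.
    by rewrite -XE -natr1; congr (_, _); ring.
  (* No entry equals [X], so the height [g] selects the piece: a half-line if [g = 0] or [g = n],
     otherwise the horizontal edge between the entries of index [g - 1] and [g]. *)
  have YE : Y = g%:R.
    by apply/le_anti; rewrite leg (le_trans leh)// ler_nat.
  have [g0|g_gt0] := posnP g.
    by left; left; rewrite /= leNgt ltg// YE g0.
  have [ltgn|legn] := ltnP g n; last first.
    have gE : g = n by lia.
    by right; rewrite /= lth prednK// YE gE; split=> //; rewrite -(ler_nat R) -gE -YE.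
  have gE : g = g.-1.+1 by rewrite prednK.
  left; right; exists g.*2 => /=; first by lia.
  rewrite gE Mpoint_even -gE Mpoint_odd.
  have ltX : X < (a`_(g.-1))%:~R by rewrite ltg; lia.
  have leX : (a`_g)%:~R <= X by rewrite leNgt ltg// ltnn.
  exists (((a`_(g.-1))%:~R - X) / ((a`_(g.-1))%:~R - (a`_g)%:~R)).
    rewrite divr_ge0 ?ler_pdivrMr; lra.
  rewrite /= YE; congr (_, _); last by ring.
  have : (a`_(g.-1))%:~R - (a`_g)%:~R != 0 :> R.
    by rewrite subr_eq0 gt_eqF// (le_lt_trans leX).
  by move: (_%:~R) (_%:~R) => u v ?; field.
Qed.
End Gamma.

(** Entries being integers, [z.1 < c] iff [floor z.1 < c], and [z.1 <= c] iff [ceil z.1 - 1 < c]: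
    the two counts become conditions on the cells at the upper right and lower left of [z]. *)
Lemma Gamma_below (R : realType) (n : nat) (a : n.-tuple int) (z : R * R) :
  (0 < n)%N -> sorted >=%R (val a) ->
  Gamma R a z <-> ~~ below a (Num.floor z.1) (Num.floor z.2)
    /\ below a (Num.ceil z.1 - 1) (Num.ceil z.2 - 1).
Proof.
move=> n_gt0 sa; rewrite Gamma_counts//.
have -> : below a (Num.floor z.1) (Num.floor z.2)
    = ~~ ((count (fun c => z.1 < c%:~R) a)%:R <= z.2).
  rewrite /below -ltNge pmulrn -floor_lt_int; congr (_ < _%:Z).
  by apply: eq_count => c; rewrite floor_lt_int.
have -> : below a (Num.ceil z.1 - 1) (Num.ceil z.2 - 1)
    = (z.2 <= (count (fun c => z.1 <= c%:~R) a)%:R).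
  rewrite /below pmulrn -ceil_le_int -lezD1 subrK; congr (_ <= _%:Z).
  by apply: eq_count => c; rewrite /= -ceil_le_int -lezD1 subrK.
by rewrite negbK.
Qed.

(** Reflection in the diagonal carries each [N_p] to the [M_p] of the shifted sequence [n + b]. *)
Lemma hatGamma_swap (R : realType) (n m : nat) (b : m.-tuple int) (z : R * R) :
  (0 < m)%N ->
  hatGamma R n b z <-> Gamma R (map_tuple (+%R n%:Z) b) (z.2, z.1).
Proof.
move=> m_gt0; set b' := map_tuple _ b.
have swap p : (0 < p <= m.*2)%N ->
    Npoint R n b p = ((Mpoint R b' p).2, (Mpoint R b' p).1).
  move=> p_int; rewrite /Npoint /Mpoint /= (nth_map 0) ?size_tuple; last by lia.
  by rewrite rmorphD.
have segE p : (0 < p < m.*2)%N ->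
    segment (Npoint R n b p) (Npoint R n b p.+1) z
    <-> segment (Mpoint R b' p) (Mpoint R b' p.+1) (z.2, z.1).
  move=> p_int; rewrite !swap; [|lia|lia].
  case: z => X Y; split=> -[t t01 /= [eX eY]]; exists t => //=;
    by rewrite eX eY.
rewrite /hatGamma /Gamma !swap; [|lia|lia]; split.
- move=> [[[eX leY]|[p p_int /(segE _ p_int) ?]]|[eX leY]].
  + by left; left.
  + by left; right; exists p.
  + by right.
- move=> [[[leY eX]|[p p_int /(segE _ p_int) ?]]|[leY eX]].
  + by left; left.
  + by left; right; exists p.
  + by right.
Qed.

(** * The weight and the union of the curves *)

(** The weight [w]; the second term has its arguments swapped because [hatGamma] is a reflected
    staircase. *)
Definition cells_below (n m : nat) (chi : n.-tuple int * m.-tuple int)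
    (x y : int) : nat :=
  below chi.1 x y + below (map_tuple (+%R n%:Z) chi.2) y x.

Lemma Xplus_sorted (n m : nat) (chi : n.-tuple int * m.-tuple int) :
  chi \in Xplus n m ->
  sorted >=%R (val chi.1) /\ sorted >=%R (val (map_tuple (+%R n%:Z) chi.2)).
Proof.
rewrite inE => /andP[sa sb]; split=> //=; rewrite sorted_map.
by apply: sub_sorted sb => x y /=; rewrite lerD2l.
Qed.

(** Both summands of the weight are monotone, so a drop of one is never offset by a rise of the
    other. *)
Lemma curves_jump (R : realType) (n m : nat) (chi : n.-tuple int * m.-tuple int)
    (z : R * R) :
  (0 < n)%N -> (0 < m)%N -> chi \in Xplus n m ->
  (Gamma R chi.1 `|` hatGamma R n chi.2) z <->
  (cells_below chi (Num.floor z.1) (Num.floor z.2)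
    < cells_below chi (Num.ceil z.1 - 1) (Num.ceil z.2 - 1))%N.
Proof.
move=> n_gt0 m_gt0 /Xplus_sorted[sa sb].
have ceil_floor1 (x : R) : Num.ceil x - 1 <= Num.floor x.
  by rewrite lerBlDr ceil_le_int ltW// floorD1_gt.
have := @below_le chi.1 _ _ _ _ (ceil_floor1 z.1) (ceil_floor1 z.2).
have := @below_le (map_tuple (+%R n%:Z) chi.2)
  _ _ _ _ (ceil_floor1 z.2) (ceil_floor1 z.1).
have -> : (Gamma R chi.1 `|` hatGamma R n chi.2) z
    <-> Gamma R chi.1 z \/ Gamma R (map_tuple (+%R n%:Z) chi.2) (z.2, z.1).
  by rewrite -hatGamma_swap.
rewrite !Gamma_below// /cells_below /=.
do 4 case: (below _ _ _) => //=; intuition.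
Qed.

(** * Recovering the weight from its drops *)

(** The drops sit exactly at [a] and [c] and total two, so a single position means a double drop:
    the positions determine the unordered pair. *)
Lemma two_steps_eq (a c a' c' : int) :
  (forall x, ((x < a)%R + (x < c)%R < (x - 1 < a)%R + (x - 1 < c)%R
    = ((x < a')%R + (x < c')%R < (x - 1 < a')%R + (x - 1 < c')%R))%N) ->
  forall x, ((x < a)%R + (x < c)%R = (x < a')%R + (x < c')%R)%N.
Proof.
have stepE (u v x : int) : ((x < u)%R + (x < v)%R < (x - 1 < u)%R + (x - 1 < v)%R)%N
    = (x == u) || (x == v).
  have -> : (x - 1 < u) = (x <= u) by lia.
  have -> : (x - 1 < v) = (x <= v) by lia.
  by case: (ltgtP x u) => _; case: (ltgtP x v).
move=> H x; have {}H t : (t == a) || (t == c) = (t == a') || (t == c').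
  by rewrite -!stepE H.
suff [[-> ->]|[-> ->]] : (a = a' /\ c = c') \/ (a = c' /\ c = a').
- by [].
- by rewrite addnC.
have := H a; have := H c; have := H a'; have := H c'; rewrite !eqxx !orbT /=.
move=> /orP[/eqP ?|/eqP ?] /orP[/eqP ?|/eqP ?]
  /esym/orP[/eqP ?|/eqP ?] /esym/orP[/eqP ?|/eqP ?]; lia.
Qed.

(** [e] is the constant contribution of [Gamma] in a row outside the strip: one below it, zero above
    it. *)
Lemma one_step_eq (e : bool) (c c' : int) :
  (forall x, (e + (x < c)%R < e + (x - 1 < c)%R
    = (e + (x < c')%R < e + (x - 1 < c')%R))%N) ->
  c = c'.
Proof.
have stepE (v x : int) : (e + (x < v)%R < e + (x - 1 < v)%R)%N = (x == v).
  have -> : (x - 1 < v) = (x <= v) by lia.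
  by rewrite ltn_add2l; case: (ltgtP x v).
by move=> H; apply/eqP; rewrite -stepE -H stepE.
Qed.

Lemma curves_eq (R : realType) (n m : nat) (chi chi' : n.-tuple int * m.-tuple int) :
  (0 < n)%N -> (0 < m)%N -> chi \in Xplus n m -> chi' \in Xplus n m ->
  Gamma R chi.1 `|` hatGamma R n chi.2 = Gamma R chi'.1 `|` hatGamma R n chi'.2
  <-> (forall x y, cells_below chi x y = cells_below chi' x y).
Proof.
move=> n_gt0 m_gt0 chiX chiX'; split=> [eqG x y|eqw]; last first.
  by apply/funext => z; apply/propext; rewrite !curves_jump// !eqw.
(* The curves are probed at the midpoints [(t, y + 1/2)] of the vertical edges. *)
have jump t : (cells_below chi t y < cells_below chi (t - 1) y
    = (cells_below chi' t y < cells_below chi' (t - 1) y))%N.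
  have fy : Num.floor (y%:~R + 2^-1 : R) = y.
    by apply: floor_def; rewrite rmorphD /=; lra.
  have cy : Num.ceil (y%:~R + 2^-1 : R) - 1 = y.
    by rewrite (@ceil_def _ _ (y + 1)) ?addrK// rmorphD /=; lra.
  have J := @curves_jump R n m _ (t%:~R, y%:~R + 2^-1) n_gt0 m_gt0.
  have := J _ chiX; have := J _ chiX'; rewrite eqG /= fy cy intrKfloor intrKceil.
  by move=> J1 J2; apply/idP/idP => [/J2/J1|/J1/J2].
have [sa sb] := Xplus_sorted chiX; have [sa' sb'] := Xplus_sorted chiX'.
(* Along a row the term of [hatGamma] drops once, at the number of columns higher than [y]. That of
   [Gamma] is constant for [y < 0] and for [n <= y], and in between drops once, at the entry of
   index [y]. *)
rewrite /cells_below; have [y_lt0|y_ge0] := ltrP y 0.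
  rewrite !(below_lt0 _ _ y_lt0) /below; congr (_ + nat_of_bool (_ < _)%R)%N.
  apply: (@one_step_eq true) => t; have := jump t.
  by rewrite /cells_below !(below_lt0 _ _ y_lt0).
have [leny|ltyn] := lerP n%:Z y.
  have out (s : n.-tuple int) t : below s t y = false.
    by rewrite below_ge_size ?size_tuple.
  rewrite !out /below; congr (_ + nat_of_bool (_ < _)%R)%N.
  apply: (@one_step_eq false) => t; have := jump t.
  by rewrite /cells_below !out.
case: y y_ge0 ltyn jump => // y _ ltyn jump.
have row (s : n.-tuple int) t : sorted >=%R (val s) -> below s t y = (t < s`_y).
  by move=> ss; rewrite belowE ?size_tuple.
rewrite !row//; apply: two_steps_eq => t.
by have := jump t; rewrite /cells_below !row.
Qed.

(** * Differences of deformed Bernoulli sums as moments *)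

(** If [y] and [y'] differed, [k] would be the rational [(x' - x) / (y - y')]. *)
Lemma int_lin_inj (C : numFieldType) (k : C) (x x' y y' : int) :
  (forall q : rat, k <> ratr q) ->
  x%:~R + k * y%:~R = x'%:~R + k * y'%:~R -> x = x' /\ y = y'.
Proof.
move=> k_irr E.
have [yE|ne_y] := eqVneq y y'.
  by move: E; rewrite yE => /addIr/intr_inj ->.
have nz : (y - y')%:~R != 0 :> C by rewrite intr_eq0 subr_eq0.
case: (k_irr ((x' - x)%:~R / (y - y')%:~R)).
rewrite fmorph_div /= !ratr_int; apply: (canRL (mulfK nz)).
transitivity ((x%:~R + k * y%:~R) - (x%:~R + k * y'%:~R)).
  by rewrite rmorphB /=; ring.
by rewrite E rmorphB /=; ring.
Qed.

(** Outside the rows [0 <= y < n] the two [below] terms cancel, so the sum extends to the whole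
    box. *)
Lemma sum_rows_diff (C : numFieldType) N n (s s' : seq int) (f : int -> int -> C) :
  (n <= N)%N -> size s = n -> size s' = n -> sorted >=%R s -> sorted >=%R s' ->
  \sum_(y < n) \sum_(i < N.*2)
     ((window N i < s`_y)%R%:R - (window N i < s'`_y)%R%:R) * f (window N i) y%:Z
  = \sum_(j < N.*2) \sum_(i < N.*2)
     ((below s (window N i) (window N j))%:R - (below s' (window N i) (window N j))%:R)
       * f (window N i) (window N j).
Proof.
move=> lenN sz sz' ss ss'.
rewrite (@sum_window _ N n (fun y => \sum_(i < N.*2)
     ((below s (window N i) y)%:R - (below s' (window N i) y)%:R)
       * f (window N i) y))//.
  by apply: eq_bigr => y _; apply: eq_bigr => i _; rewrite !belowE ?sz ?sz'.
move=> y ny; rewrite big1// => i _.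
have [y_lt0|y_ge0] := ltrP y 0; first by rewrite !below_lt0// subrr mul0r.
by rewrite !below_ge_size ?sz ?sz' ?subrr ?mul0r//; lia.
Qed.

(** The bounds put every cell where the two weights differ inside the box. *)
Lemma deformed_bsum_diff (C : numFieldType) (n m N p : nat) (k : C)
    (chi chi' : n.-tuple int * m.-tuple int) :
  k != 0 -> (n <= N)%N -> (m <= N)%N ->
  chi \in Xplus n m -> chi' \in Xplus n m ->
  (forall c, c \in (chi.1 : seq int) ++ chi'.1 -> `|c| <= N%:Z) ->
  (forall c, c \in (chi.2 : seq int) ++ chi'.2 -> `|n%:Z + c| <= N%:Z) ->
  deformed_bsum n m p.+1 k (weight_tuple C chi)
    - deformed_bsum n m p.+1 k (weight_tuple C chi')
  = p.+1%:R * \sum_(i < N.*2) \sum_(j < N.*2)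
      ((cells_below chi (window N i) (window N j))%:R
        - (cells_below chi' (window N i) (window N j))%:R)
      * ((window N i)%:~R + k * (window N j)%:~R) ^+ p.
Proof.
move=> k0 lenN lemN chiX chiX' bound1 bound2.
have [sa sb] := Xplus_sorted chiX; have [sa' sb'] := Xplus_sorted chiX'.
pose z (x y : int) := (x%:~R + k * y%:~R) ^+ p.
(* Cancels the base values subtracted in [bsum], which are the same for [chi] and [chi']. *)
have sub_sub (u v w : C) : (u - w) - (v - w) = u - v by ring.
have takeE (psi : n.-tuple int * m.-tuple int) :
    take n (weight_tuple C psi) = map intr psi.1.
  by rewrite /= map_cat take_size_cat// size_map size_tuple.
have dropE (psi : n.-tuple int * m.-tuple int) :
    drop n (weight_tuple C psi) = map intr psi.2.
  by rewrite /= map_cat drop_size_cat// size_map size_tuple.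
transitivity (p.+1%:R *
   (\sum_(y < n) \sum_(i < N.*2)
     ((window N i < chi.1`_y)%R%:R - (window N i < chi'.1`_y)%R%:R)
       * z (window N i) y%:Z
  + \sum_(x < m) \sum_(j < N.*2)
     ((window N j < (map_tuple (+%R n%:Z) chi.2)`_x)%R%:R
       - (window N j < (map_tuple (+%R n%:Z) chi'.2)`_x)%R%:R) * z x%:Z (window N j))).
  rewrite /deformed_bsum opprD addrACA -mulrBr !takeE !dropE [RHS]mulrDr; congr (_ + _).
    rewrite /bsum !size_map !size_tuple -sumrB mulr_sumr; apply: eq_bigr => y _.
    rewrite sub_sub !addr0 !(nth_map 0) ?size_tuple//.
    rewrite (@bernoulli_poly_window _ _ _ N) ?bound1 ?mem_cat ?mem_nth ?size_tuple ?orbT//.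
    by congr (_ * _); apply: eq_bigr => i _; rewrite /z [k * _ + _]addrC.
  rewrite /bsum !size_map !size_tuple -sumrB !mulr_sumr; apply: eq_bigr => x _.
  rewrite sub_sub !(nth_map 0) ?size_tuple//.
  have shift (c : int) : c%:~R + k^-1 * x%:R + n%:R = (n%:Z + c)%:~R + k^-1 * x%:R :> C.
    by rewrite rmorphD /=; ring.
  rewrite !shift.
  rewrite (@bernoulli_poly_window _ _ _ N) ?bound2 ?mem_cat ?mem_nth ?size_tuple ?orbT//.
  (* The prefactor [k ^+ p] enters the power: [k * (k^-1 * x + y) = x + k * y]. *)
  rewrite mulrCA; congr (_ * _); rewrite mulr_sumr; apply: eq_bigr => i _.
  rewrite mulrCA /z -exprMn; congr (_ * _ ^+ _).
  by rewrite mulrDr mulrA divff// mul1r.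
congr (_ * _); rewrite (sum_rows_diff z) ?size_tuple//.
rewrite (sum_rows_diff (fun x y => z y x)) ?size_tuple// exchange_big -big_split.
apply: eq_bigr => i _; rewrite -big_split; apply: eq_bigr => j _ /=.
by rewrite /cells_below !natrD /z; ring.
Qed.

Theorem theorem4p9 (R : realType) (n m : nat) (k : R[i])
    (n_gt0 : (0 < n)%N) (m_gt0 : (0 < m)%N)
    (k_irr : forall q : rat, k <> ratr q)
    (chi chi' : n.-tuple int * m.-tuple int)
    (chiX : chi \in Xplus n m) (chiX' : chi' \in Xplus n m) :
  (forall r : nat, (0 < r)%N ->
     deformed_bsum n m r k (weight_tuple R[i] chi)
     = deformed_bsum n m r k (weight_tuple R[i] chi'))
  <->
  Gamma R chi.1 `|` hatGamma R n chi.2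
  = Gamma R chi'.1 `|` hatGamma R n chi'.2.
Proof.
rewrite curves_eq//.
have k0 : k != 0 by apply/eqP => k0; apply: (k_irr 0); rewrite k0 rmorph0.
have seq_bound (s : seq int) : exists N, forall c, c \in s -> (absz c <= N)%N.
  elim: s => [|c s [N leN]]; first by exists 0%N.
  exists (maxn (absz c) N) => d; rewrite inE leq_max => /predU1P[->|/leN ->].
    by rewrite leqnn.
  by rewrite orbT.
have [N1 le1] := seq_bound ((chi.1 : seq int) ++ chi'.1).
have [N2 le2] := seq_bound ((chi.2 : seq int) ++ chi'.2).
have diffE M p (leM : (n + m + N1 + N2 <= M)%N) :=
  @deformed_bsum_diff R[i] n m M p k chi chi' k0 ltac:(lia) ltac:(lia) chiX chiX'
    ltac:(by move=> c /le1; lia) ltac:(by move=> c /le2; lia).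
split=> [eqb x y|eqw [//|p] _]; last first.
  apply/eqP; rewrite -subr_eq0 (diffE _ _ (leqnn _)).
  rewrite big1 ?mulr0// => i _; rewrite big1// => j _.
  by rewrite eqw subrr mul0r.
(* [M] exceeds [|x|] and [|y|], so the half-open window contains both. *)
pose M := (n + m + N1 + N2 + absz x + absz y + 1)%N.
pose z (ij : 'I_M.*2 * 'I_M.*2) : R[i] :=
  (window M ij.1)%:~R + k * (window M ij.2)%:~R.
pose c (ij : 'I_M.*2 * 'I_M.*2) : R[i] :=
  (cells_below chi (window M ij.1) (window M ij.2))%:R
  - (cells_below chi' (window M ij.1) (window M ij.2))%:R.
have z_inj : injective z.
  move=> [i j] [i' j'] /(int_lin_inj k_irr)[/= ei ej].
  by congr (_, _); apply/val_inj => /=; move: ei ej; rewrite /window; lia.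
have c0 := @moments_eq0 _ _ z c z_inj.
have ltx : (absz (x + M%:Z)%R < M.*2)%N by lia.
have lty : (absz (y + M%:Z)%R < M.*2)%N by lia.
have wx : window M (absz (x + M%:Z)) = x by rewrite /window; lia.
have wy : window M (absz (y + M%:Z)) = y by rewrite /window; lia.
apply/eqP; rewrite -(eqr_nat R[i]) -subr_eq0; apply/eqP.
have := c0 _ (Ordinal ltx, Ordinal lty); rewrite /c /= wx wy; apply => p.
rewrite -(pair_bigA _ (fun i j => c (i, j) * z (i, j) ^+ p)) /=.
have := diffE M p ltac:(lia); rewrite eqb// subrr => /esym/eqP.
by rewrite mulf_eq0 pnatr_eq0 => /eqP.
Qed.
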